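(* Fix a line and let $\mathcal{T}=\{1,\dots,M\}$. Let $(\iota_t)_{t\in\mathcal{T}}$ be squared currents and $(T_t)_{t\in\{0\}\cup\mathcal{T}}$ temperatures. The multi-period evolution $$T_t=f_{W_t,\Delta}(\iota_t,T_{t-1}),\qquad \forall t\in\mathcal{T},$$ is equivalent to the following finite system of equations, i.e. it holds if and only if there exist real auxiliary quantities $K_{0,t},K_{1,t},K_4,g_{1,t},g_{2,t},g_{3,t},p_t,q_t,s_{1,t},s_{2,t},h^1_t,h^2_t,h^{\mathrm{quad}}_t$ such that for all $t\in\mathcal{T}$: $$K_{0,t}=\frac{\pi D_0\epsilon\sigma T_{a,t}^4+r\iota_t+q_{s,t}-k^{c,0}_t}{mc_p},\quad K_{1,t}=\frac{k^c_t}{mc_p},\quad K_4=\frac{\pi D_0\epsilon\sigma}{mc_p},$$ $$g_{1,t}=3s_{1,t}^2-2s_{1,t}s_{2,t}+s_{2,t}^2,\quad g_{2,t}=s_{1,t}^2-2s_{1,t}s_{2,t}+3s_{2,t}^2,\quad g_{3,t}=3s_{1,t}^2-2s_{1,t}s_{2,t}+3s_{2,t}^2,$$ $$p_t=s_{2,t}-s_{1,t},\qquad q_t=s_{1,t}^2-s_{1,t}s_{2,t}+s_{2,t}^2,$$ $$K_{1,t}=K_4\,p_t\,(s_{1,t}^2+s_{2,t}^2),\qquad K_{0,t}=K_4\,q_t\,s_{1,t}s_{2,t},$$ $$(T_{t-1}-s_{1,t})e^{h^1_t}=T_t-s_{1,t},\qquad (T_{t-1}+s_{2,t})e^{h^2_t}=T_t+s_{2,t},$$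 $$e^{h^{\mathrm{quad}}_t}=\frac{T_t^2-p_tT_t+q_t}{T_{t-1}^2-p_tT_{t-1}+q_t},$$ $$K_4\Delta=-\frac{1}{s_{1,t}+s_{2,t}}\Big(\frac{h^1_t}{g_{1,t}}-\frac{h^2_t}{g_{2,t}}\Big)+\frac{s_{2,t}-s_{1,t}}{g_{1,t}g_{2,t}}h^{\mathrm{quad}}_t+\frac{4s_{1,t}s_{2,t}}{g_{1,t}g_{2,t}\sqrt{g_{3,t}}}\Big[\arctan\frac{2T_t-p_t}{\sqrt{g_{3,t}}}-\arctan\frac{2T_{t-1}-p_t}{\sqrt{g_{3,t}}}\Big].$$
   Context: Time is divided into dispatch intervals $((t-1)\Delta,t\Delta]$, $t\in\mathcal{T}$, of length $\Delta>0$; $T_t>0$ is the conductor temperature (in Kelvins) at time $t\Delta$ and $T_0>0$ is the initial temperature. $\iota_t\ge 0$ is the squared current, constant on interval $t$, and the weather $W_t$ is constant on interval $t$. The constants $m,c_p,r,D_0,\epsilon,\sigma>0$ are the line's mass, specific heat capacity, resistivity, diameter, emissivity and the Stefan--Boltzmann constant; $T_{a,t}$, $q_{s,t}$, $k^c_t$, $k^{c,0}_t$ are the ambient temperature, the solar gain and the coefficients of the linear convective loss $q^c(T)=k^c_tT+k^{c,0}_t$ on interval $t$ (determined by the weather). The function $f_{W_t,\Delta}:\mathbb{R}^+\times\mathbb{R}^+\to\mathbb{R}^+$ maps $(\iota,T_{\mathrm{in}})$ to the value at time $\tau=\Delta$ of the solution of $$\frac{dT}{d\tau}=-K_4T^4-K_{1,t}T+K_{0,t},\qquad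 T(0)=T_{\mathrm{in}},$$ with $K_4=\frac{\pi D_0\epsilon\sigma}{mc_p}$, $K_{1,t}=\frac{k^c_t}{mc_p}$, $K_{0,t}=\frac{\pi D_0\epsilon\sigma T_{a,t}^4+r\iota+q_{s,t}-k^{c,0}_t}{mc_p}$. It is assumed that $K_4>0$ and $K_{0,t}>0$; then $T^4+\frac{K_{1,t}}{K_4}T-\frac{K_{0,t}}{K_4}$ has one positive and one negative real root, which are denoted $s_{1,t}$ and $-s_{2,t}$. *)

(* Defs.v *)
From Stdlib Require Import Reals.
From Coquelicot Require Import Coquelicot.
Open Scope R_scope.

(** Physical constants of a line.  Positivity is a hypothesis
    wherever it is needed, not a field. *)
Record line : Set := Line {
  mass : R;
  heat_capacity : R;
  resistivity : R;
  diameter : R;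
  emissivity : R;
  stefan_boltzmann : R
}.

(** The weather on a dispatch interval, through the quantities it determines;
    the convective loss is [q^c(T) = conv_slope * T + conv_const]. *)
Record weather : Set := Weather {
  ambient_temp : R;
  solar_gain : R;
  conv_slope : R;
  conv_const : R
}.

Definition K4_of (L : line) : R :=
  PI * diameter L * emissivity L * stefan_boltzmann L
    / (mass L * heat_capacity L).

Definition K1_of (L : line) (W : weather) : R :=
  conv_slope W / (mass L * heat_capacity L).

(** [isq] is the squared current. *)
Definition K0_of (L : line) (W : weather) (isq : R) : R :=
  (PI * diameter L * emissivity L * stefan_boltzmann L * ambient_temp W ^ 4
     + resistivity L * isq + solar_gain W - conv_const W)
    / (mass L * heat_capacity L).

(** [y] solves the heat balance [dT/dtau = - K4 T^4 - K1 T + K0], [T(0) = Tin]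
    on [[0, Delta]].  [continuous_on] is relative to the closed interval, so
    the values of [y] outside it are irrelevant. *)
Definition heat_solution (L : line) (W : weather) (Delta isq Tin : R)
    (y : R -> R) : Prop :=
  y 0 = Tin /\
  continuous_on (fun tau => 0 <= tau <= Delta) y /\
  (forall tau, 0 < tau < Delta ->
     is_derive y tau (- K4_of L * y tau ^ 4 - K1_of L W * y tau
                      + K0_of L W isq)).

(** The map [f_{W, Delta}].  [iota] is Coquelicot's definite description: the
    value is meaningful when exactly one [Tout] satisfies the predicate. *)
Definition heat_step (L : line) (W : weather) (Delta isq Tin : R) : R :=
  iota (fun Tout : R =>
    exists y : R -> R, heat_solution L W Delta isq Tin y /\ y Delta = Tout).

(* Main.v *)
Require Import Defs.
From Stdlib Require Import Reals Lra Lia Ranalysis5 IndefiniteDescription.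
From Coquelicot Require Import Coquelicot.
Open Scope R_scope.

(** The intervals decouple, so everything happens on one of them: from the
    initial temperature [a], which temperature [b] is reached after [Delta]?

    With [s1] and [- s2] the real roots of [x^4 + (K1/K4) x - K0/K4], the heat
    balance reads [y' = - K4 (y - s1) (y + s2) (y^2 - p y + q)].  Separating
    variables and expanding in partial fractions gives the closed formula of the
    system, in which [h1], [h2] and [hquad] stand for the logarithms of the
    ratios between final and initial values of the factors.  Literal separation
    of variables breaks down at the equilibrium [y = s1] and calls for one case
    on each side of it.  This is avoided by the substitution
    [y = s1 + (a - s1) exp (- h)] ([approach]), where [h = - h1]: the new
    unknown satisfies [h' = K4 (y + s2) (y^2 - p y + q)], whose right-hand side
    is positive as long as [y > 0].  The time needed to reach [h], multiplied by
    [K4], is then the closed formula itself, as a function of [h] ([travel], with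
    the derivative of [is_derive_travel]), also when [a = s1].

    Three facts conclude.  The function [travel] starts from 0 and is unbounded,
    because its linear term dominates the others, which stay bounded along the
    path; hence it takes the value [K4 Delta] ([travel_reaches]), and inverting
    it produces a solution of the heat balance ([heat_solution_exists]).
    Solutions are unique ([heat_solution_unique]), so the definite description
    in [heat_step] denotes the end value of that solution ([heat_step_eq]).
    Finally [travel] is injective where the temperature is positive
    ([travel_injective]), so the equations determine [h1], and hence [b]; only at
    [a = s1] does the exponential relation for [h1] leave it free, and there the
    closed formula fixes it.

    The system does not say that [s1] and [s2] are positive.  As [K0 > 0], they
    have the same sign; if both are negative, then [- s2] is the positive root
    and [s1] the negative one, and all the equations are invariant under the
    exchange [(s1, s2, h1, h2) -> (- s2, - s1, h2, h1)]
    ([interval_system_swap]). *)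

(** * Uniqueness for the heat balance *)

(** Precomposition with this retraction onto [[0, b]] turns continuity relative
    to the interval into continuity at every point, the form that the mean value
    and extreme value theorems take. *)
Definition clamp (b t : R) : R := Rmax 0 (Rmin t b).

Lemma clamp_range (b t : R) : 0 <= b -> 0 <= clamp b t <= b.
Proof.
intros Hb; unfold clamp, Rmax, Rmin.
repeat destruct Rle_dec; lra.
Qed.

Lemma clamp_id (b t : R) : 0 <= t <= b -> clamp b t = t.
Proof.
intros Ht; unfold clamp, Rmax, Rmin.
repeat destruct Rle_dec; lra.
Qed.

Lemma clamp_contracts (b t u : R) :
  0 <= b -> Rabs (clamp b t - clamp b u) <= Rabs (t - u).
Proof.
intros Hb; unfold clamp, Rmax, Rmin.
repeat destruct Rle_dec; unfold Rabs; repeat destruct Rcase_abs; lra.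
Qed.

Lemma continuity_pt_clamp (b : R) (y : R -> R) :
  0 <= b -> continuous_on (fun t => 0 <= t <= b) y ->
  forall t, continuity_pt (fun u => y (clamp b u)) t.
Proof.
intros Hb Hy t; apply continuity_pt_filterlim; intros P HP.
destruct (Hy (clamp b t) (clamp_range b t Hb) P HP) as [d Hd].
exists d; intros u Hu; apply Hd.
- apply Rle_lt_trans with (2 := Hu); apply clamp_contracts, Hb.
- apply clamp_range, Hb.
Qed.

Lemma is_derive_clamp (b : R) (y : R -> R) (t l : R) :
  0 < t < b -> is_derive y t l -> is_derive (fun u => y (clamp b u)) t l.
Proof.
intros Ht; apply is_derive_ext_loc.
assert (Hd : 0 < Rmin t (b - t)) by (apply Rmin_pos; lra).
exists (mkposreal _ Hd); intros u Hu; symmetry; f_equal; apply clamp_id.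
assert (Hut : Rabs (u - t) < Rmin t (b - t)) by exact Hu.
assert (H1 := Rmin_l t (b - t)); assert (H2 := Rmin_r t (b - t)).
destruct (Rabs_def2 _ _ Hut); lra.
Qed.

(** Gronwall's argument: for two solutions [Y] and [Z], the difference of their
    derivatives is [(Y - Z) * slope] with [slope] continuous, hence bounded above
    by some [B] on the interval, and [(Y - Z)^2 exp (- 2 B t)] is nonincreasing,
    nonnegative and initially zero. *)
Lemma heat_solution_unique (L : line) (W : weather) (Delta isq Tin : R)
    (y z : R -> R) :
  0 < Delta -> heat_solution L W Delta isq Tin y ->
  heat_solution L W Delta isq Tin z -> y Delta = z Delta.
Proof.
intros HD (Hy0 & Hyc & Hyd) (Hz0 & Hzc & Hzd).
set (Y := fun t => y (clamp Delta t)); set (Z := fun t => z (clamp Delta t)).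
assert (HYc : forall t, continuity_pt Y t) by (apply continuity_pt_clamp; [lra | exact Hyc]).
assert (HZc : forall t, continuity_pt Z t) by (apply continuity_pt_clamp; [lra | exact Hzc]).
set (k4 := K4_of L) in *; set (k1 := K1_of L W) in *; set (k0 := K0_of L W isq) in *.
set (slope := fun t =>
  - k4 * (Y t * Y t * Y t + Y t * Y t * Z t + Y t * Z t * Z t + Z t * Z t * Z t) - k1).
assert (Hslope : forall t, continuity_pt slope t).
{ intros t; unfold slope.
  repeat first [ apply continuity_pt_minus | apply continuity_pt_plus
    | apply continuity_pt_mult | apply HYc | apply HZc
    | apply continuity_pt_const; intros ? ?; reflexivity ]. }
destruct (continuity_ab_maj slope 0 Delta) as (tm & Hmax & _); [lra | intros; apply Hslope |].
set (B := slope tm) in *.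
set (E := fun t => exp (- (2 * B) * t)).
set (w := fun t => (Y t - Z t) * (Y t - Z t) * E t).
destruct (MVT_gen w 0 Delta
   (fun t => 2 * ((Y t - Z t) * (Y t - Z t)) * (slope t - B) * E t))
  as (c & Hc & Hw).
- rewrite Rmin_left, Rmax_right by lra; intros t Ht.
  assert (HY := is_derive_clamp Delta y t _ Ht (Hyd t Ht)).
  assert (HZ := is_derive_clamp Delta z t _ Ht (Hzd t Ht)).
  fold Y in HY; fold Z in HZ.
  assert (Ey : y t = Y t) by (unfold Y; rewrite clamp_id; lra).
  assert (Ez : z t = Z t) by (unfold Z; rewrite clamp_id; lra).
  rewrite Ey in HY; rewrite Ez in HZ.
  unfold w, E; auto_derive.
  + repeat split; [exists (- k4 * Y t ^ 4 - k1 * Y t + k0) |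
      exists (- k4 * Z t ^ 4 - k1 * Z t + k0) |
      exists (- k4 * Y t ^ 4 - k1 * Y t + k0) |
      exists (- k4 * Z t ^ 4 - k1 * Z t + k0)]; assumption.
  + replace (Derive (fun x => Y x) t) with (- k4 * Y t ^ 4 - k1 * Y t + k0)
      by (symmetry; apply is_derive_unique; exact HY).
    replace (Derive (fun x => Z x) t) with (- k4 * Z t ^ 4 - k1 * Z t + k0)
      by (symmetry; apply is_derive_unique; exact HZ).
    unfold slope; ring.
- intros t _; unfold w, E.
  apply continuity_pt_mult.
  + apply continuity_pt_mult; apply continuity_pt_minus; auto.
  + apply continuity_pt_filterlim, (ex_derive_continuous (fun t => exp (- (2 * B) * t))).
    auto_derive; exact I.
- rewrite Rmin_left, Rmax_right in Hc by lra.
  assert (Hw0 : w 0 = 0).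
  { unfold w, Y, Z; rewrite clamp_id by lra; rewrite Hy0, Hz0; ring. }
  assert (Hsl := Hmax c Hc); fold B in Hsl.
  assert (HwD : w Delta <= 0).
  { assert (0 < E c) by apply exp_pos.
    assert (0 <= (Y c - Z c) * (Y c - Z c)) by apply Rle_0_sqr.
    assert (0 <= 2 * ((Y c - Z c) * (Y c - Z c)) * (B - slope c) * E c * Delta).
    { apply Rmult_le_pos; [apply Rmult_le_pos; [apply Rmult_le_pos|]|]; lra. }
    replace (w Delta) with (w Delta - w 0) by lra; rewrite Hw; lra. }
  unfold w in HwD; assert (0 < E Delta) by apply exp_pos.
  assert (Hsq : (Y Delta - Z Delta) * (Y Delta - Z Delta) = 0).
  { apply Rle_antisym; [|apply Rle_0_sqr].
    apply Rmult_le_reg_r with (E Delta); lra. }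
  unfold Y, Z in Hsq; rewrite clamp_id in Hsq by lra.
  apply Rmult_integral in Hsq; lra.
Qed.

(** * Autonomous equations solved by inverting the time function *)

(** If [S h] is the time needed to travel from 0 to [h] at speed [G], the inverse
    of [S] is the trajectory.  By the mean value theorem, a difference of
    positions is a difference of times multiplied by a speed [G c] at an
    intermediate point: this makes the inverse Lipschitz, and then its difference
    quotients tend to [G]. *)
Lemma inverse_solves_autonomous (G S : R -> R) (H theta : R) :
  0 < H ->
  (forall h, 0 <= h <= H ->
     0 < G h /\ continuity_pt G h /\ is_derive S h (/ G h)) ->
  S 0 = 0 -> S H = theta ->
  exists eta : R -> R,
    eta 0 = 0 /\ eta theta = H /\
    (forall t, continuity_pt eta t) /\
    (forall t, 0 < t < theta -> is_derive eta t (G (eta t))).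
Proof.
intros HH HG S0 SH.
assert (Hcont : forall h, 0 <= h <= H -> continuity_pt S h).
{ intros h Hh; apply continuity_pt_filterlim, (ex_derive_continuous S).
  eexists; apply HG, Hh. }
assert (Hmean : forall h h', 0 <= h <= H -> 0 <= h' <= H ->
  exists c, 0 <= c <= H /\ Rabs (c - h) <= Rabs (h' - h) /\ h' - h = G c * (S h' - S h)).
{ intros h h' Hh Hh'.
  assert (Hin : forall c, Rmin h h' <= c <= Rmax h h' -> 0 <= c <= H).
  { intros c; unfold Rmin, Rmax; destruct Rle_dec; lra. }
  destruct (MVT_gen S h h' (fun h => / G h)) as (c & Hc & E).
  - intros c Hc; apply HG, Hin; lra.
  - intros c Hc; apply Hcont, Hin, Hc.
  - exists c; split; [apply Hin, Hc | split].
    + revert Hc; unfold Rmin, Rmax, Rabs; destruct Rle_dec;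
        repeat destruct Rcase_abs; lra.
    + rewrite E; destruct (HG c (Hin c Hc)); field; lra. }
assert (Htheta : 0 < theta).
{ destruct (Hmean 0 H) as (c & Hc & _ & E); try lra.
  rewrite S0, SH in E; destruct (HG c Hc) as (Gc & _).
  apply Rmult_lt_reg_l with (G c); lra. }
destruct (functional_choice (fun t h => 0 <= h <= H /\ S h = clamp theta t)) as (eta & Heta).
{ intros t; destruct (f_interv_is_interv S 0 H (clamp theta t)) as (h & Hh).
  - exact HH.
  - rewrite S0, SH; apply clamp_range; lra.
  - exact Hcont.
  - exists h; exact Hh. }
destruct (continuity_ab_maj G 0 H) as (hm & Hmax & Hhm); [lra | intros; apply HG; assumption |].
set (C := G hm) in *.
assert (HC : 0 < C) by (apply HG, Hhm).
assert (Hlip : forall t u, Rabs (eta u - eta t) <= C * Rabs (u - t)).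
{ intros t u; destruct (Heta t) as (Ht & Et), (Heta u) as (Hu & Eu).
  destruct (Hmean _ _ Ht Hu) as (c & Hc & _ & ->).
  rewrite Et, Eu, Rabs_mult.
  apply Rmult_le_compat; try apply Rabs_pos.
  - rewrite Rabs_pos_eq; [apply Hmax, Hc | apply Rlt_le, HG, Hc].
  - apply clamp_contracts; lra. }
exists eta; split; [|split; [|split]].
- destruct (Heta 0) as (Ht & Et); destruct (Hmean 0 (eta 0)) as (c & _ & _ & E); try lra.
  rewrite S0, Et, clamp_id in E by lra; lra.
- destruct (Heta theta) as (Ht & Et); destruct (Hmean H (eta theta)) as (c & _ & _ & E); try lra.
  rewrite SH, Et, clamp_id in E by lra; lra.
- intros t e He; exists (e / C); split; [apply Rdiv_lt_0_compat; lra|].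
  intros u (_ & Hu); simpl in *; unfold R_dist, Rdist in *.
  apply Rle_lt_trans with (1 := Hlip t u).
  apply Rmult_lt_compat_l with (r := C) in Hu; [|exact HC].
  replace (C * (e / C)) with e in Hu by (field; lra); exact Hu.
- intros t Ht; apply is_derive_Reals; intros e He.
  destruct (HG _ (proj1 (Heta t))) as (_ & Gc & _).
  destruct (Gc e He) as (d & Hd & Hclose).
  (* the two last bounds keep [t + u] within the range where [clamp] is the identity *)
  assert (Hdelta : 0 < Rmin (d / C) (Rmin t (theta - t))).
  { repeat apply Rmin_pos; try lra; apply Rdiv_lt_0_compat; lra. }
  exists (mkposreal _ Hdelta); intros u Hu0 Hu; simpl in Hu.
  assert (Hu1 : Rabs u < d / C) by (eapply Rlt_le_trans; [exact Hu | apply Rmin_l]).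
  assert (Hu2 : Rabs u < Rmin t (theta - t)) by (eapply Rlt_le_trans; [exact Hu | apply Rmin_r]).
  assert (Hu3 := Rlt_le_trans _ _ _ Hu2 (Rmin_l _ _)).
  assert (Hu4 := Rlt_le_trans _ _ _ Hu2 (Rmin_r _ _)).
  apply Rabs_def2 in Hu3; apply Rabs_def2 in Hu4.
  destruct (Heta t) as (Hr & Et), (Heta (t + u)) as (Hr' & Et').
  destruct (Hmean _ _ Hr Hr') as (c & Hc & Hcd & E).
  rewrite E, Et, Et', !clamp_id by lra.
  replace (G c * (t + u - t) / u) with (G c) by (field; exact Hu0).
  (* the limit of [G] at [eta t] is stated on punctured neighbourhoods *)
  destruct (Req_dec c (eta t)) as [-> | Hne].
  { rewrite Rminus_diag, Rabs_R0; exact He. }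
  apply Hclose; split; [split; [exact I | intros Eq; apply Hne; symmetry; exact Eq]|].
  simpl; unfold Rdist.
  apply Rle_lt_trans with (1 := Hcd), Rle_lt_trans with (1 := Hlip t (t + u)).
  replace (t + u - t) with u by ring.
  apply Rmult_lt_compat_l with (r := C) in Hu1; [|exact HC].
  replace (C * (d / C)) with d in Hu1 by (field; lra); exact Hu1.
Qed.

(** * The equations of one interval *)

(** The quadratic factor left in the quartic [x^4 + (K1/K4) x - K0/K4] by the
    roots [s1] and [- s2]. *)
Definition quad (s1 s2 x : R) : R :=
  x ^ 2 - (s2 - s1) * x + (s1 ^ 2 - s1 * s2 + s2 ^ 2).

Definition quad_at_pos_root (s1 s2 : R) : R := 3 * s1 ^ 2 - 2 * s1 * s2 + s2 ^ 2.
Definition quad_at_neg_root (s1 s2 : R) : R := s1 ^ 2 - 2 * s1 * s2 + 3 * s2 ^ 2.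

(** The opposite of the discriminant of [quad]. *)
Definition opp_disc (s1 s2 : R) : R := 3 * s1 ^ 2 - 2 * s1 * s2 + 3 * s2 ^ 2.

(** [theta] stands for [K4 Delta]; the quantities [p], [q], [g1], [g2], [g3] are
    replaced by their values, so that the unknowns are the roots and the
    logarithms only. *)
Definition interval_system (s1 s2 a b theta h1 h2 hq : R) : Prop :=
  (a - s1) * exp h1 = b - s1 /\
  (a + s2) * exp h2 = b + s2 /\
  exp hq = quad s1 s2 b / quad s1 s2 a /\
  theta
  = - (1 / (s1 + s2)) * (h1 / quad_at_pos_root s1 s2 - h2 / quad_at_neg_root s1 s2)
    + (s2 - s1) / (quad_at_pos_root s1 s2 * quad_at_neg_root s1 s2) * hq
    + 4 * s1 * s2
      / (quad_at_pos_root s1 s2 * quad_at_neg_root s1 s2 * sqrt (opp_disc s1 s2))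
      * (atan ((2 * b - (s2 - s1)) / sqrt (opp_disc s1 s2))
         - atan ((2 * a - (s2 - s1)) / sqrt (opp_disc s1 s2))).

(** Each of the three is a positive combination of [s1^2], [s2^2] and
    [(s1 - s2)^2]. *)
Lemma root_values_pos (s1 s2 : R) : 0 < s1 -> 0 < s2 ->
  0 < quad_at_pos_root s1 s2 /\ 0 < quad_at_neg_root s1 s2 /\ 0 < opp_disc s1 s2.
Proof.
intros H1 H2; unfold quad_at_pos_root, quad_at_neg_root, opp_disc.
assert (0 < s1 * s1) by (apply Rmult_lt_0_compat; assumption).
assert (0 < s2 * s2) by (apply Rmult_lt_0_compat; assumption).
assert (0 <= (s1 - s2) * (s1 - s2)) by apply Rle_0_sqr.
repeat split; lra.
Qed.

(** [4 * quad s1 s2 x] is the square of [2 * x - (s2 - s1)] plus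
    [opp_disc s1 s2]. *)
Lemma quad_pos (s1 s2 x : R) : 0 < s1 -> 0 < s2 -> 0 < quad s1 s2 x.
Proof.
intros H1 H2; destruct (root_values_pos s1 s2 H1 H2) as (_ & _ & Hd).
assert (0 <= (2 * x - (s2 - s1)) * (2 * x - (s2 - s1))) by apply Rle_0_sqr.
unfold quad, opp_disc in *; lra.
Qed.

(** The unordered pair of roots [{s1, - s2}] is unchanged by the exchange, and the
    equations depend on nothing else, once [h1] and [h2] follow their roots. *)
Lemma interval_system_swap (s1 s2 a b theta h1 h2 hq : R) :
  interval_system s1 s2 a b theta h1 h2 hq ->
  interval_system (- s2) (- s1) a b theta h2 h1 hq.
Proof.
unfold interval_system; intros (E1 & E2 & E3 & E4).
replace (quad_at_pos_root (- s2) (- s1)) with (quad_at_neg_root s1 s2)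
  by (unfold quad_at_pos_root, quad_at_neg_root; ring).
replace (quad_at_neg_root (- s2) (- s1)) with (quad_at_pos_root s1 s2)
  by (unfold quad_at_pos_root, quad_at_neg_root; ring).
replace (opp_disc (- s2) (- s1)) with (opp_disc s1 s2) by (unfold opp_disc; ring).
replace (- s1 - - s2) with (s2 - s1) by ring.
repeat split.
- replace (a - - s2) with (a + s2) by ring; lra.
- replace (a + - s1) with (a - s1) by ring; lra.
- rewrite E3; unfold quad; f_equal; [|f_equal]; ring.
- rewrite E4.
  replace (- s2 + - s1) with (- (s1 + s2)) by ring.
  replace (4 * - s2 * - s1) with (4 * s1 * s2) by ring.
  replace (1 / - (s1 + s2)) with (- (1 / (s1 + s2)))
    by (unfold Rdiv; rewrite Rinv_opp; ring).
  rewrite (Rmult_comm (quad_at_neg_root s1 s2) (quad_at_pos_root s1 s2)); ring.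
Qed.

(** * The closed formula as a travel time *)

(** The part of the partial fraction primitive without the term in
    [ln |x - s1|], hence smooth at the equilibrium [s1]. *)
Definition regular_part (s1 s2 x : R) : R :=
  ln (x + s2) / ((s1 + s2) * quad_at_neg_root s1 s2)
  + (s2 - s1) / (quad_at_pos_root s1 s2 * quad_at_neg_root s1 s2) * ln (quad s1 s2 x)
  + 4 * s1 * s2
      / (quad_at_pos_root s1 s2 * quad_at_neg_root s1 s2 * sqrt (opp_disc s1 s2))
      * atan ((2 * x - (s2 - s1)) / sqrt (opp_disc s1 s2)).

(** The temperature as a function of minus the logarithm of its distance to the
    equilibrium, relative to the initial distance; for [h >= 0] it runs from [a]
    towards [s1], and it is constant when [a = s1]. *)
Definition approach (s1 a h : R) : R := s1 + (a - s1) * exp (- h).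

(** The right-hand side of the last equation of [interval_system] with
    [h1 = - h], that is, [K4] times the time to go from [a] to [approach s1 a h]. *)
Definition travel (s1 s2 a h : R) : R :=
  h / ((s1 + s2) * quad_at_pos_root s1 s2)
  + (regular_part s1 s2 (approach s1 a h) - regular_part s1 s2 a).

Lemma is_derive_regular_part (s1 s2 x : R) : 0 < s1 -> 0 < s2 -> 0 < x ->
  is_derive (regular_part s1 s2) x
    (1 / ((s1 + s2) * quad_at_neg_root s1 s2 * (x + s2))
     + (s2 - s1) / (quad_at_pos_root s1 s2 * quad_at_neg_root s1 s2)
         * ((2 * x - (s2 - s1)) / quad s1 s2 x)
     + 2 * s1 * s2 / (quad_at_pos_root s1 s2 * quad_at_neg_root s1 s2 * quad s1 s2 x)).
Proof.
intros H1 H2 Hx.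
destruct (root_values_pos s1 s2 H1 H2) as (Hg1 & Hg2 & Hg3).
assert (Hq := quad_pos s1 s2 x H1 H2).
assert (Hr := sqrt_lt_R0 _ Hg3).
assert (Hr2 := sqrt_sqrt _ (Rlt_le _ _ Hg3)).
(* completing the square removes the square root from the derivative of [atan] *)
assert (E4 : sqrt (opp_disc s1 s2) * sqrt (opp_disc s1 s2)
             + (2 * x - (s2 - s1)) * (2 * x - (s2 - s1)) = 4 * quad s1 s2 x).
{ rewrite Hr2; unfold opp_disc, quad; ring. }
set (r := sqrt (opp_disc s1 s2)) in *.
unfold regular_part; fold r.
set (g1 := quad_at_pos_root s1 s2) in *; set (g2 := quad_at_neg_root s1 s2) in *.
apply (is_derive_plus (fun x => _ + _) _); [apply (is_derive_plus (fun x => _ / _) _)|].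
- auto_derive; [lra | field; lra].
- unfold quad in *; auto_derive; [lra | field; lra].
- auto_derive; [exact I|].
  replace (1 + _) with (4 * quad s1 s2 x / (r * r)).
  + field; lra.
  + rewrite <- E4; field; lra.
Qed.

(** Along [approach], [dx = - (x - s1) dh], and the partial fraction expansion makes
    [(x - s1)] times the derivative of [regular_part] equal to
    [1 / ((s1 + s2) * quad_at_pos_root s1 s2) - 1 / ((x + s2) * quad s1 s2 x)];
    the linear term of [travel], which is what the logarithm of [|x - s1|] has
    become, cancels the constant. *)
Lemma is_derive_travel (s1 s2 a h : R) : 0 < s1 -> 0 < s2 -> 0 < approach s1 a h ->
  is_derive (travel s1 s2 a) h
    (/ ((approach s1 a h + s2) * quad s1 s2 (approach s1 a h))).
Proof.
intros H1 H2 Hx.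
destruct (root_values_pos s1 s2 H1 H2) as (Hg1 & Hg2 & Hg3).
assert (Hq := quad_pos s1 s2 (approach s1 a h) H1 H2).
assert (Hpath : is_derive (approach s1 a) h (- (approach s1 a h - s1))).
{ unfold approach; auto_derive; [exact I | ring]. }
assert (Hreg := is_derive_comp _ _ _ _ _ (is_derive_regular_part s1 s2 _ H1 H2 Hx) Hpath).
set (x := approach s1 a h) in *.
unfold travel.
evar_last.
{ apply (is_derive_plus (fun h => _ / _) (fun h => _ - _)).
  - auto_derive; [exact I | reflexivity].
  - apply (is_derive_minus (fun h => regular_part s1 s2 (approach s1 a h)) (fun _ => _)).
    + exact Hreg.
    + apply is_derive_const. }
unfold plus, minus, opp, plus, scal, zero; simpl; unfold mult; simpl.
unfold quad, quad_at_pos_root, quad_at_neg_root in *.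
field; repeat split; lra.
Qed.

Lemma approach_0 (s1 a : R) : approach s1 a 0 = a.
Proof. unfold approach; rewrite Ropp_0, exp_0; ring. Qed.

Lemma travel_0 (s1 s2 a : R) : travel s1 s2 a 0 = 0.
Proof. unfold travel; rewrite approach_0; unfold Rdiv; ring. Qed.

Lemma exp_nondecreasing (x y : R) : x <= y -> exp x <= exp y.
Proof.
intros [H | ->]; [apply Rlt_le, exp_increasing, H | apply Rle_refl].
Qed.

Lemma approach_between (s1 a h : R) :
  0 <= h -> Rmin a s1 <= approach s1 a h <= Rmax a s1.
Proof.
intros Hh; unfold approach.
assert (0 < exp (- h)) by apply exp_pos.
assert (exp (- h) <= 1) by (rewrite <- exp_0; apply exp_nondecreasing; lra).
unfold Rmin, Rmax; destruct Rle_dec; nra.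
Qed.

Lemma approach_pos (s1 a h : R) :
  0 < s1 -> 0 < a -> 0 <= h -> 0 < approach s1 a h.
Proof.
intros Hs Ha Hh.
apply Rlt_le_trans with (2 := proj1 (approach_between s1 a h Hh)).
apply Rmin_pos; assumption.
Qed.

(** Needed for negative [h] too: the sign of the auxiliary quantity [h1] is not
    known a priori, only that the final temperature is positive. *)
Lemma approach_pos_between (s1 a h h' u : R) : h <= u <= h' ->
  0 < approach s1 a h -> 0 < approach s1 a h' -> 0 < approach s1 a u.
Proof.
unfold approach; intros (Hu & Hu').
assert (exp (- u) <= exp (- h)) by (apply exp_nondecreasing; lra).
assert (exp (- h') <= exp (- u)) by (apply exp_nondecreasing; lra).
destruct (Rle_dec a s1); nra.
Qed.

Lemma travel_injective (s1 s2 a h h' : R) : 0 < s1 -> 0 < s2 ->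
  0 < approach s1 a h -> 0 < approach s1 a h' ->
  travel s1 s2 a h = travel s1 s2 a h' -> h = h'.
Proof.
intros H1 H2 Hh Hh' E.
assert (Hpos : forall u, Rmin h h' <= u <= Rmax h h' -> 0 < approach s1 a u).
{ intros u; unfold Rmin, Rmax; destruct Rle_dec; intros Hu;
    [apply approach_pos_between with h h' | apply approach_pos_between with h' h];
    assumption. }
destruct (MVT_gen (travel s1 s2 a) h h'
  (fun u => / ((approach s1 a u + s2) * quad s1 s2 (approach s1 a u))))
  as (c & Hc & EM).
- intros u Hu; apply is_derive_travel; try assumption; apply Hpos; lra.
- intros u Hu; apply continuity_pt_filterlim, (ex_derive_continuous (travel s1 s2 a)).
  eexists; apply is_derive_travel; try assumption; apply Hpos, Hu.
- rewrite E, Rminus_diag in EM.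
  assert (Hx := Hpos c Hc); assert (Hq := quad_pos s1 s2 (approach s1 a c) H1 H2).
  assert (0 < / ((approach s1 a c + s2) * quad s1 s2 (approach s1 a c))).
  { apply Rinv_0_lt_compat, Rmult_lt_0_compat; lra. }
  symmetry in EM; apply Rmult_integral in EM; lra.
Qed.

(** The temperature stays between [a] and [s1], where [regular_part] is bounded
    below, so the linear term eventually exceeds any [theta]. *)
Lemma travel_reaches (s1 s2 a theta : R) : 0 < s1 -> 0 < s2 -> 0 < a -> 0 < theta ->
  exists h, 0 < h /\ travel s1 s2 a h = theta.
Proof.
intros H1 H2 Ha Ht.
destruct (root_values_pos s1 s2 H1 H2) as (Hg1 & _).
assert (Hmin : 0 < Rmin a s1) by (apply Rmin_pos; assumption).
destruct (continuity_ab_min (regular_part s1 s2) (Rmin a s1) (Rmax a s1)) as (xm & Hm & _).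
{ unfold Rmin, Rmax; destruct Rle_dec; lra. }
{ intros x Hx; apply continuity_pt_filterlim, (ex_derive_continuous (regular_part s1 s2)).
  eexists; apply is_derive_regular_part; lra. }
assert (Hma : regular_part s1 s2 xm <= regular_part s1 s2 a).
{ apply Hm; split; [apply Rmin_l | apply Rmax_l]. }
set (g := (s1 + s2) * quad_at_pos_root s1 s2).
assert (Hg : 0 < g) by (apply Rmult_lt_0_compat; lra).
(* [h0 / g] offsets the largest possible decrease of [regular_part] *)
set (h0 := g * (theta + (regular_part s1 s2 a - regular_part s1 s2 xm))).
assert (Hh0 : 0 < h0) by (apply Rmult_lt_0_compat; lra).
destruct (f_interv_is_interv (travel s1 s2 a) 0 h0 theta) as (h & Hh & E).
- exact Hh0.
- rewrite travel_0; split; [lra|].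
  unfold travel; fold g.
  replace (h0 / g) with (theta + (regular_part s1 s2 a - regular_part s1 s2 xm))
    by (unfold h0; field; lra).
  assert (Hx := Hm _ (approach_between s1 a h0 (Rlt_le _ _ Hh0))); lra.
- intros h Hh; apply continuity_pt_filterlim, (ex_derive_continuous (travel s1 s2 a)).
  eexists; apply is_derive_travel; try assumption; apply approach_pos; lra.
- exists h; split; [|exact E].
  destruct (Req_dec h 0) as [-> | Hne]; [rewrite travel_0 in E; lra | lra].
Qed.

(** The equations with exponentials force [h2] and [hq] to be differences of
    logarithms; [h1] is kept as the unknown, since [a - s1] may vanish. *)
Lemma interval_system_travel (s1 s2 a b theta h1 h2 hq : R) :
  0 < s1 -> 0 < s2 -> 0 < a -> 0 < b ->
  interval_system s1 s2 a b theta h1 h2 hq ->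
  approach s1 a (- h1) = b /\ travel s1 s2 a (- h1) = theta.
Proof.
intros H1 H2 Ha Hb (E1 & E2 & E3 & E4).
destruct (root_values_pos s1 s2 H1 H2) as (Hg1 & Hg2 & Hg3).
assert (Hqa := quad_pos s1 s2 a H1 H2); assert (Hqb := quad_pos s1 s2 b H1 H2).
assert (Hr := sqrt_lt_R0 _ Hg3).
assert (Eb : approach s1 a (- h1) = b) by (unfold approach; rewrite Ropp_involutive; lra).
split; [exact Eb|].
assert (Eh2 : h2 = ln (b + s2) - ln (a + s2)).
{ rewrite <- E2, ln_mult, ln_exp; [ring | lra | apply exp_pos]. }
assert (Ehq : hq = ln (quad s1 s2 b) - ln (quad s1 s2 a)).
{ rewrite <- ln_div, <- E3, ln_exp by assumption; reflexivity. }
unfold travel; rewrite Eb, E4, Eh2, Ehq; unfold regular_part.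
field; repeat split; lra.
Qed.

Lemma travel_interval_system (s1 s2 a h : R) :
  0 < s1 -> 0 < s2 -> 0 < a -> 0 < approach s1 a h ->
  exists h1 h2 hq,
    interval_system s1 s2 a (approach s1 a h) (travel s1 s2 a h) h1 h2 hq.
Proof.
intros H1 H2 Ha Hb.
destruct (root_values_pos s1 s2 H1 H2) as (Hg1 & Hg2 & Hg3).
assert (Hqa := quad_pos s1 s2 a H1 H2).
assert (Hqb := quad_pos s1 s2 (approach s1 a h) H1 H2).
assert (Hr := sqrt_lt_R0 _ Hg3).
exists (- h), (ln (approach s1 a h + s2) - ln (a + s2)),
  (ln (quad s1 s2 (approach s1 a h)) - ln (quad s1 s2 a)); repeat split.
- unfold approach; ring.
- rewrite <- ln_div, exp_ln by (try apply Rdiv_lt_0_compat; lra); field; lra.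
- rewrite <- ln_div, exp_ln by (try apply Rdiv_lt_0_compat; lra); reflexivity.
- unfold travel, regular_part; field; repeat split; lra.
Qed.

(** * The heat step *)

(** Vieta's formulas: [- k4 x^4 - k1 x + k0] is
    [- k4 (x - s1) (x + s2) (quad s1 s2 x)]. *)
Definition vieta_relations (k4 k1 k0 s1 s2 : R) : Prop :=
  k1 = k4 * (s2 - s1) * (s1 ^ 2 + s2 ^ 2) /\
  k0 = k4 * (s1 ^ 2 - s1 * s2 + s2 ^ 2) * s1 * s2.

Lemma heat_solution_exists (L : line) (W : weather) (Delta isq s1 s2 a : R) :
  0 < Delta -> 0 < K4_of L -> 0 < s1 -> 0 < s2 -> 0 < a ->
  vieta_relations (K4_of L) (K1_of L W) (K0_of L W isq) s1 s2 ->
  exists h y, 0 < h /\ travel s1 s2 a h = K4_of L * Delta /\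
    heat_solution L W Delta isq a y /\ y Delta = approach s1 a h.
Proof.
intros HD Hk4 H1 H2 Ha (Ek1 & Ek0).
unfold heat_solution; rewrite Ek1, Ek0; set (k4 := K4_of L) in *.
destruct (travel_reaches s1 s2 a (k4 * Delta)) as (h & Hh & Eh); try assumption.
{ apply Rmult_lt_0_compat; assumption. }
set (rate := fun u => k4 * ((approach s1 a u + s2) * quad s1 s2 (approach s1 a u))).
destruct (inverse_solves_autonomous rate (fun u => travel s1 s2 a u / k4) h Delta)
  as (eta & eta0 & etaD & etac & etad).
- exact Hh.
- intros u Hu; assert (Hx := approach_pos s1 a u H1 Ha (proj1 Hu)).
  assert (Hq := quad_pos s1 s2 (approach s1 a u) H1 H2).
  assert (Hp : 0 < (approach s1 a u + s2) * quad s1 s2 (approach s1 a u))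
    by (apply Rmult_lt_0_compat; lra).
  split; [|split].
  + apply Rmult_lt_0_compat; assumption.
  + apply continuity_pt_filterlim, (ex_derive_continuous rate).
    unfold rate, quad, approach; auto_derive; exact I.
  + unfold rate.
    apply is_derive_ext with (fun u => / k4 * travel s1 s2 a u).
    { intros v; unfold Rdiv; apply Rmult_comm. }
    rewrite Rinv_mult; apply (is_derive_scal (travel s1 s2 a)).
    apply is_derive_travel; assumption.
- rewrite travel_0; unfold Rdiv; ring.
- rewrite Eh; field; lra.
- assert (Hpath : forall u, is_derive (approach s1 a) u (- (approach s1 a u - s1))).
  { intros u; unfold approach; auto_derive; [exact I | ring]. }
  exists h, (fun t => approach s1 a (eta t)).
  split; [exact Hh | split; [exact Eh | split; [split; [|split]|]]].
  + rewrite eta0; apply approach_0.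
  + apply continuous_on_forall; intros t _.
    apply (continuous_comp eta (approach s1 a)).
    * apply continuity_pt_filterlim, etac.
    * apply (ex_derive_continuous (approach s1 a)); eexists; apply Hpath.
  + intros t Ht.
    evar_last; [apply (is_derive_comp (approach s1 a) eta); [apply Hpath | apply etad, Ht]|].
    unfold scal; simpl; unfold mult; simpl; unfold rate, quad; ring.
  + rewrite etaD; reflexivity.
Qed.

Lemma heat_step_eq (L : line) (W : weather) (Delta isq Tin : R) (y : R -> R) :
  0 < Delta -> heat_solution L W Delta isq Tin y ->
  heat_step L W Delta isq Tin = y Delta.
Proof.
intros HD Hy.
apply (iota_unique (V := R_CompleteNormedModule)).
- intros Tout (z & Hz & <-); apply (heat_solution_unique L W Delta isq Tin); assumption.
- exists y; split; [exact Hy | reflexivity].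
Qed.

Lemma heat_step_iff (L : line) (W : weather) (Delta isq s1 s2 a b : R) :
  0 < Delta -> 0 < K4_of L -> 0 < s1 -> 0 < s2 -> 0 < a -> 0 < b ->
  vieta_relations (K4_of L) (K1_of L W) (K0_of L W isq) s1 s2 ->
  b = heat_step L W Delta isq a <->
  exists h1 h2 hq, interval_system s1 s2 a b (K4_of L * Delta) h1 h2 hq.
Proof.
intros HD Hk4 H1 H2 Ha Hb Hroots.
destruct (heat_solution_exists L W Delta isq s1 s2 a) as (h & y & Hh & Eh & Hy & Ey);
  try assumption.
assert (Hpos := approach_pos s1 a h H1 Ha (Rlt_le _ _ Hh)).
rewrite (heat_step_eq L W Delta isq a y HD Hy), Ey, <- Eh; split.
- intros ->; apply travel_interval_system; assumption.
- intros (h1 & h2 & hq & Hsys).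
  apply interval_system_travel in Hsys; try assumption.
  destruct Hsys as (<- & E).
  f_equal; apply (travel_injective s1 s2 a); assumption.
Qed.

(** * Existence and signs of the real roots *)

Lemma quartic_positive_root (k c : R) : 0 < c -> exists s, 0 < s /\ s ^ 4 + k * s = c.
Proof.
intros Hc.
(* at [b], [b^3 + k >= 1 + c] and [b >= 1], so the quartic term exceeds [c] *)
set (b := 1 + Rabs k + c).
assert (Hk := Rle_abs (- k)); rewrite Rabs_Ropp in Hk.
assert (Hk0 := Rabs_pos k).
assert (Hb : 1 <= b) by (unfold b; lra).
destruct (f_interv_is_interv (fun s => s ^ 4 + k * s) 0 b c) as (s & Hs & E).
- lra.
- split; [simpl; lra|].
  assert (b <= b * (b * b)) by nra.
  assert (b * (1 + c) <= b * (b * (b * b) + k)) by (apply Rmult_le_compat_l; unfold b in *; lra).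
  simpl; nra.
- intros s _; apply continuity_pt_filterlim, (ex_derive_continuous (fun s => s ^ 4 + k * s)).
  auto_derive; exact I.
- exists s; split; [|exact E].
  destruct (Req_dec s 0) as [-> | Hne]; [simpl in E; lra | lra].
Qed.

(** The opposites of the negative roots are the positive roots of the quartic with
    [k1] negated.  Subtracting the equations of [s1] and [s2] and dividing by
    [s1 + s2] gives the relation for [k1], from which the one for [k0] follows. *)
Lemma vieta_relations_exist (k4 k1 k0 : R) : 0 < k4 -> 0 < k0 ->
  exists s1 s2, 0 < s1 /\ 0 < s2 /\ vieta_relations k4 k1 k0 s1 s2.
Proof.
intros Hk4 Hk0.
assert (Hc : 0 < k0 / k4) by (apply Rdiv_lt_0_compat; assumption).
destruct (quartic_positive_root (k1 / k4) _ Hc) as (s1 & H1 & E1).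
destruct (quartic_positive_root (- (k1 / k4)) _ Hc) as (s2 & H2 & E2).
assert (Ek : k1 / k4 = (s2 - s1) * (s1 ^ 2 + s2 ^ 2)).
{ apply Rmult_eq_reg_r with (s1 + s2); lra. }
exists s1, s2; repeat split; try assumption.
- replace k1 with (k4 * (k1 / k4)) by (field; lra); rewrite Ek; ring.
- replace k0 with (k4 * (k0 / k4)) by (field; lra); rewrite <- E1, Ek; ring.
Qed.

Lemma vieta_relations_swap (k4 k1 k0 s1 s2 : R) :
  vieta_relations k4 k1 k0 s1 s2 -> vieta_relations k4 k1 k0 (- s2) (- s1).
Proof. intros (E1 & E2); split; [rewrite E1 | rewrite E2]; ring. Qed.

(** The sign of [k0] is that of [s1 * s2], as [s1^2 - s1 s2 + s2^2 >= 0]. *)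
Lemma vieta_relations_same_sign (k4 k1 k0 s1 s2 : R) : 0 < k4 -> 0 < k0 ->
  vieta_relations k4 k1 k0 s1 s2 -> (0 < s1 /\ 0 < s2) \/ (s1 < 0 /\ s2 < 0).
Proof.
intros Hk4 Hk0 (_ & E).
assert (Hprod : 0 < s1 * s2).
{ apply Rnot_le_lt; intros Hle.
  assert (0 <= s1 ^ 2 - s1 * s2 + s2 ^ 2) by nra.
  assert (0 <= k4 * (s1 ^ 2 - s1 * s2 + s2 ^ 2)) by (apply Rmult_le_pos; lra).
  nra. }
destruct (Rtotal_order s1 0) as [Hs | [-> | Hs]].
- right; split; nra.
- lra.
- left; split; nra.
Qed.

Lemma interval_system_heat_step (L : line) (W : weather)
    (Delta isq s1 s2 a b h1 h2 hq : R) :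
  0 < Delta -> 0 < K4_of L -> 0 < K0_of L W isq -> 0 < a -> 0 < b ->
  vieta_relations (K4_of L) (K1_of L W) (K0_of L W isq) s1 s2 ->
  interval_system s1 s2 a b (K4_of L * Delta) h1 h2 hq ->
  b = heat_step L W Delta isq a.
Proof.
intros HD Hk4 Hk0 Ha Hb Hroots Hsys.
destruct (vieta_relations_same_sign _ _ _ _ _ Hk4 Hk0 Hroots) as [(H1 & H2) | (H1 & H2)].
- apply (heat_step_iff L W Delta isq s1 s2); try assumption.
  exists h1, h2, hq; exact Hsys.
- apply (heat_step_iff L W Delta isq (- s2) (- s1)); try assumption; try lra.
  + apply vieta_relations_swap, Hroots.
  + exists h2, h1, hq; apply interval_system_swap, Hsys.
Qed.

(** * The multi-period evolution *)

Theorem proposition8 :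
  forall (L : line) (Delta : R) (M : nat) (W : nat -> weather)
         (isq T : nat -> R),
    0 < mass L -> 0 < heat_capacity L -> 0 < resistivity L ->
    0 < diameter L -> 0 < emissivity L -> 0 < stefan_boltzmann L ->
    0 < Delta ->
    (forall t : nat, (1 <= t <= M)%nat -> 0 <= isq t) ->
    (forall t : nat, (t <= M)%nat -> 0 < T t) ->
    0 < K4_of L ->
    (forall t : nat, (1 <= t <= M)%nat -> 0 < K0_of L (W t) (isq t)) ->
    ((forall t : nat, (1 <= t <= M)%nat ->
        T t = heat_step L (W t) Delta (isq t) (T (t - 1)%nat))
     <->
     (exists (K0 K1 : nat -> R) (K4 : R) (g1 g2 g3 p q s1 s2 h1 h2 hquad : nat -> R),
        forall t : nat, (1 <= t <= M)%nat ->
          K0 t = (PI * diameter L * emissivity L * stefan_boltzmann L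
                    * ambient_temp (W t) ^ 4
                  + resistivity L * isq t + solar_gain (W t) - conv_const (W t))
                 / (mass L * heat_capacity L) /\
          K1 t = conv_slope (W t) / (mass L * heat_capacity L) /\
          K4 = PI * diameter L * emissivity L * stefan_boltzmann L
               / (mass L * heat_capacity L) /\
          g1 t = 3 * s1 t ^ 2 - 2 * s1 t * s2 t + s2 t ^ 2 /\
          g2 t = s1 t ^ 2 - 2 * s1 t * s2 t + 3 * s2 t ^ 2 /\
          g3 t = 3 * s1 t ^ 2 - 2 * s1 t * s2 t + 3 * s2 t ^ 2 /\
          p t = s2 t - s1 t /\
          q t = s1 t ^ 2 - s1 t * s2 t + s2 t ^ 2 /\
          K1 t = K4 * p t * (s1 t ^ 2 + s2 t ^ 2) /\
          K0 t = K4 * q t * s1 t * s2 t /\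
          (T (t - 1)%nat - s1 t) * exp (h1 t) = T t - s1 t /\
          (T (t - 1)%nat + s2 t) * exp (h2 t) = T t + s2 t /\
          exp (hquad t)
            = (T t ^ 2 - p t * T t + q t)
              / (T (t - 1)%nat ^ 2 - p t * T (t - 1)%nat + q t) /\
          K4 * Delta
            = - (1 / (s1 t + s2 t)) * (h1 t / g1 t - h2 t / g2 t)
              + (s2 t - s1 t) / (g1 t * g2 t) * hquad t
              + 4 * s1 t * s2 t / (g1 t * g2 t * sqrt (g3 t))
                * (atan ((2 * T t - p t) / sqrt (g3 t))
                   - atan ((2 * T (t - 1)%nat - p t) / sqrt (g3 t))))).
Proof.
intros L Delta M W isq T _ _ _ _ _ _ HD _ HT Hk4 Hk0; split.
- intros Hstep.
  destruct (functional_choice (fun (t : nat) (v : R * R * (R * R * R)) =>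
    let '(s1, s2, (h1, h2, hq)) := v in
    (1 <= t <= M)%nat ->
    vieta_relations (K4_of L) (K1_of L (W t)) (K0_of L (W t) (isq t)) s1 s2 /\
    interval_system s1 s2 (T (t - 1)%nat) (T t) (K4_of L * Delta) h1 h2 hq))
    as (v & Hv).
  { intros t.
    destruct (Compare_dec.le_dec 1 t) as [Ht1 | Ht1];
      [|exists (0, 0, (0, 0, 0)); intros; lia].
    destruct (Compare_dec.le_dec t M) as [Ht2 | Ht2];
      [|exists (0, 0, (0, 0, 0)); intros; lia].
    destruct (vieta_relations_exist _ (K1_of L (W t)) _ Hk4 (Hk0 t (conj Ht1 Ht2)))
      as (s1 & s2 & H1 & H2 & Hroots).
    destruct (proj1 (heat_step_iff L (W t) Delta (isq t) s1 s2 (T (t - 1)%nat) (T t)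
      HD Hk4 H1 H2 (HT (t - 1)%nat ltac:(lia)) (HT t Ht2) Hroots) (Hstep t (conj Ht1 Ht2)))
      as (h1 & h2 & hq & Hsys).
    exists (s1, s2, (h1, h2, hq)); intros _; split; assumption. }
  set (s1 := fun t => fst (fst (v t))); set (s2 := fun t => snd (fst (v t))).
  exists (fun t => K0_of L (W t) (isq t)), (fun t => K1_of L (W t)), (K4_of L),
    (fun t => quad_at_pos_root (s1 t) (s2 t)),
    (fun t => quad_at_neg_root (s1 t) (s2 t)),
    (fun t => opp_disc (s1 t) (s2 t)),
    (fun t => s2 t - s1 t),
    (fun t => s1 t ^ 2 - s1 t * s2 t + s2 t ^ 2),
    s1, s2,
    (fun t => fst (fst (snd (v t)))), (fun t => snd (fst (snd (v t)))),
    (fun t => snd (snd (v t))).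
  intros t Ht; specialize (Hv t); unfold s1, s2; clear s1 s2.
  destruct (v t) as ((s1, s2), ((h1, h2), hq)).
  destruct (Hv Ht) as ((Ek1 & Ek0) & E1 & E2 & E3 & E4); simpl fst; simpl snd.
  do 8 (split; [reflexivity|]).
  split; [exact Ek1|]; split; [exact Ek0|]; split; [exact E1|]; split; [exact E2|].
  split; [exact E3 | exact E4].
- intros (K0 & K1 & K4 & g1 & g2 & g3 & p & q & s1 & s2 & h1 & h2 & hq & Hsys) t Ht.
  destruct (Hsys t Ht) as (EK0 & EK1 & EK4 & Eg1 & Eg2 & Eg3 & Ep & Eq & Er1 & Er0
    & E1 & E2 & E3 & E4).
  change (K0 t = K0_of L (W t) (isq t)) in EK0; change (K1 t = K1_of L (W t)) in EK1;
    change (K4 = K4_of L) in EK4.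
  rewrite Ep, Eq in *; rewrite EK0, EK1, EK4, Eg1, Eg2, Eg3 in *.
  apply (interval_system_heat_step L (W t) Delta (isq t) (s1 t) (s2 t) _ _
    (h1 t) (h2 t) (hq t)); try assumption.
  + apply Hk0, Ht.
  + apply HT; lia.
  + apply HT; lia.
  + split; assumption.
  + split; [exact E1 | split; [exact E2 | split; [exact E3 | exact E4]]].
Qed.
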